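(* Let $\bar G$ be a finite group satisfying the $(\mu,\lambda)$-property, and let $G$ be a finite group that is a Frattini extension of $\bar G$, i.e. $G$ has a normal subgroup $N$ with $N\leq\Phi(G)$ and $G/N\cong\bar G$. Then $G$ satisfies the $(\mu,\lambda)$-property.
   Context: $\Phi(G)$ is the Frattini subgroup of $G$ (the intersection of all maximal subgroups of $G$). For a finite poset $\mathcal{P}$, the Möbius function $\mu_{\mathcal{P}}:\mathcal{P}\times\mathcal{P}\to\mathbb{Z}$ is defined by $\mu_{\mathcal{P}}(x,y)=0$ if $x\not\leq y$, $\mu_{\mathcal{P}}(x,x)=1$, and $\mu_{\mathcal{P}}(x,y)=-\sum_{x<z\leq y}\mu_{\mathcal{P}}(z,y)$ if $x<y$. For a finite group $G$, let $\mathcal{L}$ be the lattice of all subgroups of $G$ ordered by inclusion, and let $\mathcal{C}$ be the poset of conjugacy classes $[H]$ of subgroups $H\leq G$, ordered by $[H]\leq[K]$ if and only if $H\leq K^g$ for some $g\in G$. For $H\leq G$ put $\mu(H)=\mu_{\mathcal{L}}(H,G)$ and $\lambda(H)=\mu_{\mathcal{C}}([H],[G])$. $G'$ is the derived (commutator) subgroup of $G$, and $N_{G'}(H)=\{g\in G' : H^g=H\}$. The group $G$ satisfies the $(\mu,\lambda)$-property if $\mu(H)=[N_{G'}(H):G'\cap H]\cdot\lambda(H)$ for every $H\leq G$. *)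

(* Defs.v *)
From HB Require Import structures.
From mathcomp Require Import all_boot all_order all_algebra all_fingroup all_solvable.

Set Implicit Arguments.
Unset Strict Implicit.
Unset Printing Implicit Defensive.

Import Order.TTheory GRing.Theory.
Local Open Scope group_scope.

Section Mobius.

Variables (d : Order.disp_t) (P : finPOrderType d).
Implicit Types x y z : P.
Local Open Scope order_scope.

(* [n] is only fuel for the recursion: [mobius0], [mobiusxx] and [mobius_lt]
   below are the defining equations. *)
Fixpoint mobius_rec (n : nat) x y : int :=
  if x == y then 1%R
  else if x < y then
    (if n is n'.+1 then - \sum_(z | (x < z <= y)%O) mobius_rec n' z y else 0)%R
  else 0%R.

Definition mobius x y : int := mobius_rec #|P| x y.

Lemma mobius_rec_fuel m n x y :
    (#|[set z | (x < z)%O]| <= m)%N -> (#|[set z | (x < z)%O]| <= n)%N ->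
  mobius_rec m x y = mobius_rec n x y.
Proof.
elim: m n x => [|m IHm] [|n] x //= lem len; case: eqP => // _;
  case: ifP => // ltxy.
- by have := cards0_eq (eqP (etrans (esym (leqn0 _)) lem));
    move/setP/(_ y); rewrite !inE ltxy.
- by have := cards0_eq (eqP (etrans (esym (leqn0 _)) len));
    move/setP/(_ y); rewrite !inE ltxy.
congr (- _)%R; apply: eq_bigr => z /andP[ltxz _].
have ltcard: (#|[set t | (z < t)%O]| < #|[set t | (x < t)%O]|)%N.
  apply: proper_card; apply/properP; split.
    by apply/subsetP=> t; rewrite !inE; apply: lt_trans.
  by exists z; rewrite !inE ?ltxx.
by apply: IHm; rewrite -ltnS (leq_trans ltcard).
Qed.

Lemma mobius0 x y : ~~ (x <= y) -> mobius x y = 0%R.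
Proof.
rewrite /mobius; case: #|P| => [|n] /= nlexy; case: eqP nlexy => [->|_];
  rewrite ?lexx // => nlexy; by case: ifP => // /ltW; rewrite (negPf nlexy).
Qed.

Lemma mobiusxx x : mobius x x = 1%R.
Proof. by rewrite /mobius; case: #|P| => [|n] /=; rewrite eqxx. Qed.

Lemma mobius_lt x y :
  x < y -> mobius x y = (- \sum_(z | (x < z <= y)%O) mobius z y)%R.
Proof.
move=> ltxy; rewrite {1}/mobius.
rewrite (@mobius_rec_fuel _ #|P|.+1) ?max_card //; last first.
  exact: leq_trans (max_card _) (leqnSn _).
by rewrite /= (lt_eqF ltxy) ltxy.
Qed.

End Mobius.

Section SubgroupLattice.

Variables (gT : finGroupType) (G : {group gT}).

Record subgroup_of := SubgroupOf {
  subgroup_val :> {group gT};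
  subgroup_sub : subgroup_val \subset G
}.

HB.instance Definition _ := [isSub for subgroup_val].
HB.instance Definition _ := [Finite of subgroup_of by <:].

Definition subgroup_le (H K : subgroup_of) := H \subset K.

Lemma subgroup_le_refl : reflexive subgroup_le.
Proof. by move=> H; apply: subxx. Qed.

Lemma subgroup_le_anti : antisymmetric subgroup_le.
Proof.
by move=> H K; rewrite /subgroup_le -eqEsubset => /eqP eqHK;
  apply/val_inj/group_inj.
Qed.

Lemma subgroup_le_trans : transitive subgroup_le.
Proof. by move=> K H L; apply: subset_trans. Qed.

Fact subgroup_display : Order.disp_t. Proof. exact: Order.Disp tt tt. Qed.

HB.instance Definition _ := Order.Le_isPOrder.Build subgroup_display subgroup_of
  subgroup_le_refl subgroup_le_anti subgroup_le_trans.

Definition whole_subgroup : subgroup_of := SubgroupOf (subxx G).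

End SubgroupLattice.

Section ClassPoset.

Variables (gT : finGroupType) (G : {group gT}).

(* The action ['JG] is conjugation of subgroups, so that
   [orbit 'JG G H] is [{H :^ g | g \in G}]. *)
Record subgroup_class := SubgroupClass {
  class_val :> {set {group gT}};
  class_valP : class_val \in [set orbit 'JG G H | H : {group gT} in subgroups G]
}.

HB.instance Definition _ := [isSub for class_val].
HB.instance Definition _ := [Finite of subgroup_class by <:].

Fact class_of_subproof (H : subgroup_of G) :
  orbit 'JG G H \in [set orbit 'JG G K | K : {group gT} in subgroups G].
Proof. by apply: imset_f; rewrite inE subgroup_sub. Qed.

Definition class_of (H : subgroup_of G) : subgroup_class :=
  SubgroupClass (class_of_subproof H).

(* Independent of the representatives [H] and [K], see [class_leE]. *)
Definition class_le (C D : subgroup_class) : bool :=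
  [exists H in (C : {set {group gT}}), exists K in (D : {set {group gT}}),
    [exists g in G, H \subset K :^ g]].

Lemma class_ofP (C : subgroup_class) : exists H, C = class_of H.
Proof.
case: C => C CP; have /imsetP[H] := CP; rewrite inE => sHG defC.
by exists (SubgroupOf sHG); apply: val_inj.
Qed.

Lemma class_leP (H K : subgroup_of G) :
  reflect (exists2 g, g \in G & H \subset K :^ g)
          (class_le (class_of H) (class_of K)).
Proof.
apply: (iffP exists_inP) => [[_ /orbitP[a aG <-]] | [g gG sHKg]].
  case/exists_inP=> _ /orbitP[b bG <-] /exists_inP[g gG] /=.
  rewrite -conjsgM sub_conjg -conjsgM => sHK.
  by exists (b * g * a^-1); rewrite ?groupM ?groupV.
exists (val H); first exact: orbit_refl.
apply/exists_inP; exists (val K); first exact: orbit_refl.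
by apply/exists_inP; exists g.
Qed.

Lemma class_leE (H K : subgroup_of G) :
  class_le (class_of H) (class_of K) = [exists g in G, H \subset K :^ g].
Proof. exact/class_leP/exists_inP. Qed.

Lemma class_le_refl : reflexive class_le.
Proof.
move=> C; have [H ->] := class_ofP C; apply/class_leP.
by exists 1; rewrite ?group1 ?conjsg1.
Qed.

Lemma class_le_anti : antisymmetric class_le.
Proof.
move=> C D; have [H ->] := class_ofP C; have [K ->] := class_ofP D.
case/andP=> /class_leP[g gG sHKg] /class_leP[h hG sKHh].
apply: val_inj => /=; apply: orbit_eqP.
apply/orbitP; exists g => //; apply/group_inj/eqP; rewrite /= eq_sym eqEcard.
by rewrite sHKg cardJg -(cardJg H h) subset_leq_card.
Qed.

Lemma class_le_trans : transitive class_le.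
Proof.
move=> D C E; have [H ->] := class_ofP C; have [K ->] := class_ofP D.
have [L ->] := class_ofP E => /class_leP[g gG sHKg] /class_leP[h hG sKLh].
apply/class_leP; exists (h * g); first exact: groupM.
by apply: subset_trans sHKg _; rewrite conjsgM conjSg.
Qed.

Fact subgroup_class_display : Order.disp_t.
Proof. exact: Order.Disp tt tt. Qed.

HB.instance Definition _ := Order.Le_isPOrder.Build subgroup_class_display
  subgroup_class class_le_refl class_le_anti class_le_trans.

End ClassPoset.

Section MuLambda.

Variables (gT : finGroupType) (G : {group gT}).

Definition mu_sub (H : subgroup_of G) : int := mobius H (whole_subgroup G).

Definition lambda_sub (H : subgroup_of G) : int :=
  mobius (class_of H) (class_of (whole_subgroup G)).

Definition mu_lambda_property : Prop :=
  forall H : subgroup_of G,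
    mu_sub H = (#|'N_(G^`(1))(H) : G^`(1) :&: H|%g%:Z * lambda_sub H)%R.

End MuLambda.

(* Main.v *)
Require Import Defs.
From mathcomp Require Import all_boot all_order all_algebra all_fingroup all_solvable.

Set Implicit Arguments.
Unset Strict Implicit.
Unset Printing Implicit Defensive.

Import Order.TTheory GRing.Theory.
Local Open Scope group_scope.

(** The statement reduces to a transfer principle for Moebius functions along
a Galois insertion.  Let [f : P -> Q] and [g : Q -> P] be adjoint, with [g] an
order embedding, and suppose that only the top of [P] is sent to the top of [Q].
Then the Moebius number of [x] below the top is that of [f x] if [x] is closed,
that is [g (f x) = x], and vanishes otherwise ([mobius_galois]).

Let [phi] map [G] onto [Gbar] with kernel [N].  Image and preimage under [phi]
form a Galois insertion from the subgroup lattice of [G] to that of [Gbar], and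
so they do between the posets of conjugacy classes.  The condition on tops is
where [N \subset 'Phi(G)] enters: [phi @* H = phi @* G] means [N * H = G], which
forces [H = G] ([Frattini_ker_eq]).  In both posets the closed elements are those coming from the
[H] that contain [N].  For the other [H] both sides of the required equation
vanish.  For [H] containing [N], both Moebius numbers are those of [phi @* H],
and the index is unchanged ([index_subnorm_morphim]), because the part of [N]
inside [G^`(1)] lies in [G^`(1) :&: H]. *)

Section MobiusGalois.

Local Open Scope order_scope.

Lemma mobius_sum (d : Order.disp_t) (P : finPOrderType d) (x y : P) :
  x <= y -> (\sum_(z | (x <= z <= y)%O) mobius z y = (x == y)%:R)%R.
Proof.
move=> lexy; rewrite (bigD1 x) /= ?lexx //; case: eqP => [<- | /eqP neqxy].
  rewrite mobiusxx big1 ?addr0 // => z /andP[/le_anti->].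
  by rewrite eqxx.
rewrite mobius_lt ?lt_neqAle ?neqxy //.
apply/eqP; rewrite addrC subr_eq0; apply/eqP; apply: eq_bigl => z.
by rewrite andbAC lt_neqAle [x == z]eq_sym [(x <= z) && _]andbC.
Qed.

(** The relations of [mobius_sum] determine the values on [z <= y], by
downward induction. *)
Lemma mobius_unique (d : Order.disp_t) (P : finPOrderType d) (y : P)
    (F : P -> int) :
  (forall x, x <= y -> (\sum_(z | (x <= z <= y)%O) F z = (x == y)%:R)%R) ->
  forall x, x <= y -> F x = mobius x y.
Proof.
move=> sumF x; move: {2}_.+1 (ltnSn #|[set z | x < z]|) => n.
elim: n x => // n IHn x ltn lexy.
have := sumF x lexy; rewrite -(mobius_sum lexy).
rewrite (bigD1 x) ?lexx //= [RHS](bigD1 x) ?lexx //=.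
have -> : (\sum_(z | (x <= z <= y)%O && (z != x)) F z
           = \sum_(z | (x <= z <= y)%O && (z != x)) mobius z y)%R.
  apply: eq_bigr => z /andP[/andP[lexz lezy] neqzx].
  have ltxz : x < z by rewrite lt_neqAle eq_sym neqzx.
  apply: IHn lezy; apply: leq_trans (ltn : (_ <= n)%N).
  apply: proper_card; apply/properP; split.
    by apply/subsetP=> t; rewrite !inE; apply: lt_trans.
  by exists z; rewrite !inE ?ltxx.
exact: addIr.
Qed.

(** Summing the claimed values over [z >= x] leaves only the closed
[z = g q], and by adjunction [x <= g q] means [f x <= q]; the sum is thus one
of the defining sums of the Moebius function of [Q], equal to 1 if [f x] is
the top and to 0 otherwise, as required. *)
Lemma mobius_galois (d e : Order.disp_t) (P : finPOrderType d)
    (Q : finPOrderType e) (f : P -> Q) (g : Q -> P) (tP : P) (tQ : Q) :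
  (forall x q, (f x <= q) = (x <= g q)) ->
  (forall q r, g q <= g r -> q <= r) ->
  (forall x, x <= tP) -> (forall q, q <= tQ) ->
  (forall x, f x = tQ -> x = tP) ->
  forall x, mobius x tP = if g (f x) == x then mobius (f x) tQ else 0%R.
Proof.
move=> adj gemb topP topQ ftop x.
have fgK q : f (g q) = q.
  by apply/le_anti/andP; split; [rewrite adj | apply: gemb; rewrite -adj].
have fP : f tP = tQ.
  apply/le_anti; rewrite topQ -(fgK tQ) adj.
  by apply: le_trans (topP _) _; rewrite -adj.
symmetry; move: (topP x); move: x; apply: mobius_unique => x _.
transitivity (\sum_(z | (x <= z)%O && (g (f z) == z)) mobius (f z) tQ)%R.
  rewrite [RHS]big_mkcondr; apply: eq_bigl => z; by rewrite topP andbT.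
rewrite (reindex_onto g f) => [|z /andP[_ /eqP//]].
transitivity (\sum_(q | (f x <= q <= tQ)%O) mobius q tQ)%R.
  rewrite (eq_bigl (fun q => f x <= q <= tQ)) => [|q].
    by apply: eq_bigr => q _; rewrite fgK.
  by rewrite !fgK !eqxx !andbT adj topQ andbT.
rewrite mobius_sum //; congr (_%:R)%R; congr nat_of_bool.
by apply/eqP/eqP=> [/ftop | ->].
Qed.

End MobiusGalois.

Section ClassRepresentatives.

Variables (T : finGroupType) (A : {group T}).
Implicit Types (H : subgroup_of A) (C : subgroup_class A).

Lemma class_of_top C :
  (C <= class_of (whole_subgroup A))%O.
Proof.
have [H ->] := class_ofP C; apply/class_leP; exists 1 => //=.
by rewrite conjsg1 subgroup_sub.
Qed.

Lemma class_of_eq_top H :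
  class_of H = class_of (whole_subgroup A) -> H = whole_subgroup A.
Proof.
move=> eqHA; apply/val_inj/group_inj/eqP; rewrite eqEsubset subgroup_sub /=.
have /class_leP[g gA] : (class_of (whole_subgroup A) <= class_of H)%O.
  by rewrite eqHA.
by rewrite -sub_conjgV /= conjGid ?groupV.
Qed.

Fact class_rep_subproof C : exists H, C == class_of H.
Proof. by have [H ->] := class_ofP C; exists H. Qed.

Definition class_rep C := xchoose (class_rep_subproof C).

Lemma class_repK : cancel class_rep (@class_of T A).
Proof. by move=> C; apply/esym/eqP/(xchooseP (class_rep_subproof C)). Qed.

End ClassRepresentatives.

Section FrattiniMorphism.

Variables (aT rT : finGroupType) (G : {group aT}) (phi : {morphism G >-> rT}).
Implicit Types (H K : subgroup_of G) (L M : subgroup_of (phi @* G)).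

Lemma index_subnorm_morphim H :
    'ker phi \subset H ->
  #|'N_((phi @* G)^`(1))(phi @* H) : (phi @* G)^`(1) :&: phi @* H|
  = #|'N_(G^`(1))(H) : G^`(1) :&: H|.
Proof.
move=> sKH; have sHG := subgroup_sub H.
rewrite -morphim_der // -morphim_subnormG // -morphimIG //.
rewrite -(index_morphim_ker phi (G := 'N_(G^`(1))(H)) (H := G^`(1) :&: H)).
- rewrite (_ : #|'ker_('N_(G^`(1))(H)) phi : _| = 1)%N ?muln1 //.
  by apply/eqP; rewrite indexg_eq1 /= setIAC -setIA setIS // subIset ?sKH.
- by rewrite setIS ?normG.
by rewrite subIset // der_sub.
Qed.

Lemma Frattini_ker_eq H :
  'ker phi \subset 'Phi(G) -> phi @* H = phi @* G -> H :=: G.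
Proof.
move=> sKPhi eqHG; have sHG := subgroup_sub H.
rewrite -(genGid H); apply: Phi_nongen; apply/eqP.
rewrite eqEsubset join_subG Phi_sub sHG /=.
have eqG : phi @*^-1 (phi @* H) = G by rewrite eqHG morphimGK ?subsetIl.
rewrite -{1}eqG morphimK // mul_subG ?joing_subr //.
by rewrite (subset_trans sKPhi) ?joing_subl.
Qed.

Definition im_sub H : subgroup_of (phi @* G) :=
  @SubgroupOf _ _ (phi @* H)%G (morphimS phi (subgroup_sub H)).

Definition pre_sub L : subgroup_of G :=
  @SubgroupOf _ _ (phi @*^-1 L)%G (subsetIl _ _).

Lemma im_pre_sub_adj H L : (im_sub H <= L)%O = (H <= pre_sub L)%O.
Proof. exact: sub_morphim_pre (subgroup_sub H). Qed.

Lemma pre_subK : cancel pre_sub im_sub.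
Proof.
by move=> L; apply/val_inj/group_inj; rewrite /= morphpreK ?subgroup_sub.
Qed.

Lemma pre_sub_closedP H :
  reflect (pre_sub (im_sub H) = H) ('ker phi \subset H).
Proof.
apply: (iffP idP) => [sKH | <-]; last exact: ker_sub_pre.
by apply/val_inj/group_inj; rewrite /= morphimGK ?subgroup_sub.
Qed.

Lemma mu_sub_morphim H :
    'ker phi \subset 'Phi(G) ->
  mu_sub H = if 'ker phi \subset H then mu_sub (im_sub H) else 0%R.
Proof.
move=> sKPhi; rewrite /mu_sub.
rewrite (mobius_galois (f := im_sub) (g := pre_sub)
           (tQ := whole_subgroup (phi @* G))).
- by rewrite (sameP eqP (pre_sub_closedP H)).
- exact: im_pre_sub_adj.
- by move=> L M; rewrite -im_pre_sub_adj pre_subK.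
- exact: subgroup_sub.
- exact: subgroup_sub.
move=> K /(congr1 val)/(congr1 val)/= eqK; apply/val_inj/group_inj.
exact: Frattini_ker_eq.
Qed.

(** Every element of [phi @* G] is some [phi g], and conjugating by [phi g] below
corresponds to conjugating by [g] above. *)
Lemma class_im_pre_adj H L :
  (class_of (im_sub H) <= class_of L)%O = (class_of H <= class_of (pre_sub L))%O.
Proof.
apply/class_leP/class_leP => [[_ /morphimP[g gG _ ->]] | [g gG]] /= sHL.
  by exists g; rewrite // -morphpreJ // -sub_morphim_pre ?subgroup_sub.
exists (phi g); rewrite ?mem_morphim //.
by rewrite sub_morphim_pre ?subgroup_sub // morphpreJ.
Qed.

Lemma class_pre_emb L M :
  (class_of (pre_sub L) <= class_of (pre_sub M))%O ->
  (class_of L <= class_of M)%O.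
Proof. by rewrite -class_im_pre_adj pre_subK. Qed.

Definition class_im (C : subgroup_class G) : subgroup_class (phi @* G) :=
  class_of (im_sub (class_rep C)).

Definition class_pre (D : subgroup_class (phi @* G)) : subgroup_class G :=
  class_of (pre_sub (class_rep D)).

Lemma class_im_adj C D : (class_im C <= D)%O = (C <= class_pre D)%O.
Proof. by rewrite -{1}(class_repK D) class_im_pre_adj class_repK. Qed.

(** By [class_im_pre_adj] both classes have the same upper bounds, whatever
representative [class_im] picks. *)
Lemma class_imE H : class_im (class_of H) = class_of (im_sub H).
Proof.
have eq_le D : (class_im (class_of H) <= D)%O = (class_of (im_sub H) <= D)%O.
  by rewrite -(class_repK D) !class_im_pre_adj class_repK.
by apply/le_anti; rewrite eq_le lexx -eq_le lexx.
Qed.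

Lemma class_preE L : class_pre (class_of L) = class_of (pre_sub L).
Proof.
have eq_ge C : (C <= class_pre (class_of L))%O
                = (C <= class_of (pre_sub L))%O.
  by rewrite -class_im_adj -{2}(class_repK C) -class_im_pre_adj.
by apply/le_anti; rewrite eq_ge lexx -eq_ge lexx.
Qed.

(** A subgroup conjugate to its closure has the order of its closure, hence
is closed: passing to classes creates no new closed elements. *)
Lemma class_closedP H :
  reflect (class_pre (class_im (class_of H)) = class_of H)
          ('ker phi \subset H).
Proof.
rewrite class_imE class_preE.
apply: (iffP (pre_sub_closedP H)) => [-> // | eqC].
have /class_leP[g gG /subset_leq_card] :
  (class_of (pre_sub (im_sub H)) <= class_of H)%O by rewrite eqC.
rewrite cardJg => leHH; apply/esym/val_inj/group_inj/eqP.
by rewrite eqEcard leHH andbT -sub_morphim_pre ?subgroup_sub.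
Qed.

Lemma lambda_sub_morphim H :
    'ker phi \subset 'Phi(G) ->
  lambda_sub H = if 'ker phi \subset H then lambda_sub (im_sub H) else 0%R.
Proof.
move=> sKPhi; rewrite /lambda_sub.
rewrite (mobius_galois (f := class_im) (g := class_pre)
           (tQ := class_of (whole_subgroup (phi @* G)))).
- by rewrite (sameP eqP (class_closedP H)) class_imE.
- exact: class_im_adj.
- by move=> C D /class_pre_emb; rewrite !class_repK.
- exact: class_of_top.
- exact: class_of_top.
move=> C; rewrite -(class_repK C) class_imE => /class_of_eq_top.
move/(congr1 val)/(congr1 val)=> /= eqK; congr class_of; apply/val_inj/group_inj.
exact: Frattini_ker_eq.
Qed.

Lemma mu_lambda_Frattini :
    'ker phi \subset 'Phi(G) ->
  mu_lambda_property (phi @* G) -> mu_lambda_property G.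
Proof.
move=> sKPhi muG H; rewrite mu_sub_morphim // lambda_sub_morphim //.
case: ifP => [sKH | _]; last by rewrite mulr0.
by rewrite muG /= index_subnorm_morphim.
Qed.

End FrattiniMorphism.

Lemma quotient_isog_morphism (rT gT : finGroupType) (L : {group rT})
    (G N : {group gT}) :
  N <| G -> G / N \isog L ->
  exists2 phi : {morphism G >-> rT}, 'ker phi = N & phi @* G = L.
Proof.
case/andP=> sNG nNG /isogP[f injf imf].
have sGD : G \subset coset N @*^-1 (G / N) by rewrite -sub_morphim_pre.
(* The domain of the composite is only provably equal to [G], whence the
restriction. *)
exists (restrm_morphism sGD (f \o coset N)%type).
  rewrite ker_restrm ker_comp (trivgP injf) -kerE ker_coset.
  exact/setIidPr.
by rewrite morphim_restrm setIid morphim_comp.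
Qed.

Theorem mainTheorem9 (rT gT : finGroupType) (Gbar : {group rT})
    (G N : {group gT}) :
  mu_lambda_property Gbar ->
  N <| G -> N \subset 'Phi(G) -> G / N \isog Gbar ->
  mu_lambda_property G.
Proof.
move=> muGbar nsNG sNPhi isoGbar.
have [phi kerphi imphi] := quotient_isog_morphism nsNG isoGbar.
apply: (mu_lambda_Frattini (phi := phi)); first by rewrite kerphi.
by rewrite (_ : (phi @* G)%G = Gbar) //; apply: group_inj.
Qed.
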